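(* Let $G$ be a comb and let $D$ be an oriented graph missing $G$. Then $D$ has a vertex $v$ with $d^{+}_D(v)\le d^{++}_D(v)$.
   Context: Graphs and digraphs are finite, with nonempty vertex set in the case of $D$; graphs are simple. An oriented graph is a digraph without loops, parallel arcs or digons (directed cycles of length 2). For a vertex $v$ of an oriented graph $D$, $N^{+}_D(v)$ is the set of out-neighbors of $v$ and $d^{+}_D(v)=|N^{+}_D(v)|$. $N^{++}_D(v)$ is the second out-neighborhood: the set of vertices at distance exactly 2 from $v$, i.e. the out-neighbors of out-neighbors of $v$, excluding $N^{+}_D(v)$; $d^{++}_D(v)=|N^{++}_D(v)|$. A missing edge of $D$ is an unordered pair $xy$ of distinct vertices with $(x,y)\notin E(D)$ and $(y,x)\notin E(D)$. $D$ is missing a graph $G$ if $V(G)\subseteq V(D)$ and $E(G)$ is exactly the set of missing edges of $D$ (isolated vertices of $G$ are allowed). A chair is a graph on 5 distinct vertices $x,y,z,t,v$ whose edges are exactly $xy,yz,zt,zv$; the co-chair is its complement. $C_n$ is the cycle on $n$ vertices and $\overline{H}$ is the complement of $H$. A comb is a graph having no induced subgraph isomorphic to $C_4$, $\overline{C_4}$, $C_5$, chair or co-chair. *)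

(* Defs.v *)
From mathcomp Require Import all_boot.
Set Implicit Arguments.
Unset Strict Implicit.
Unset Printing Implicit Defensive.

(* A simple graph whose vertices lie in T; its vertex set may be a proper
   subset of T and may contain isolated vertices. *)
Record sgraph (T : finType) := SGraph {
  vertices : {set T};
  edge : rel T;
  edge_sym : symmetric edge;
  edge_irr : irreflexive edge;
  edge_vertices : forall x y, edge x y -> x \in vertices
}.

(* Antisymmetry says that there is no digon; parallel arcs cannot occur in a
   relation. *)
Definition oriented (V : finType) (D : rel V) : Prop :=
  irreflexive D /\ antisymmetric D.

Definition outN (V : finType) (D : rel V) (v : V) : {set V} := [set w | D v w].

(* When D is oriented, v itself is never an out-neighbor of one of its
   out-neighbors, so this is the set of vertices at distance exactly 2. *)
Definition outN2 (V : finType) (D : rel V) (v : V) : {set V} :=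
  (\bigcup_(u in outN D v) outN D u) :\: outN D v.

Definition missing_edge (V : finType) (D : rel V) : rel V :=
  [rel x y | [&& x != y, ~~ D x y & ~~ D y x]].

(* The vertex set of D is all of V, so V(G) is contained in V(D) by typing. *)
Definition missing (V : finType) (D : rel V) (G : sgraph V) : Prop :=
  edge G =2 missing_edge D.

Definition compl_rel (I : finType) (h : rel I) : rel I :=
  [rel i j | (i != j) && ~~ h i j].

(* The adjacency relation of C_n, for n >= 3; ordS is successor modulo n. *)
Definition cycle_rel (n : nat) : rel 'I_n :=
  [rel i j | (j == ordS i) || (i == ordS j)].

(* Vertices x, y, z, t, v are numbered 0, 1, 2, 3, 4. *)
Definition chair_edges : seq (nat * nat) :=
  [:: (0, 1); (1, 2); (2, 3); (2, 4)].

Definition chair_rel : rel 'I_5 :=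
  [rel i j | ((val i, val j) \in chair_edges)
          || ((val j, val i) \in chair_edges)].

Definition has_induced (T : finType) (G : sgraph T) (I : finType) (h : rel I)
    : Prop :=
  exists f : I -> T,
    [/\ injective f,
        forall i, f i \in vertices G
      & forall i j, edge G (f i) (f j) = h i j].

Definition comb (T : finType) (G : sgraph T) : Prop :=
  [/\ ~ has_induced G (@cycle_rel 4),
      ~ has_induced G (compl_rel (@cycle_rel 4)),
      ~ has_induced G (@cycle_rel 5),
      ~ has_induced G chair_rel
    & ~ has_induced G (compl_rel chair_rel)].

(* Main.v *)
(* A comb is a split graph with clique K in which, for two vertices p, q on the
   same side of the split, N(p) \ N(q) and N(q) \ N(p) are singletons as soon as
   both are nonempty.

   Say that b is reached from a if it is at distance 1 or 2 from a, that the
   missing edge ab loses to the missing edge cd if a -> c, b -> d, d is not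
   reached from a and c is not reached from b, and that (a, b) is convenient if b
   is reached from every in-neighbor of a.  Losing is injective and acyclic, hence
   decomposes the missing edges into directed paths; a missing edge that nothing
   loses to has a convenient orientation.  Orient the first edge of each path
   conveniently and propagate along the path, which completes D to a tournament T.
   Let f be the last vertex of a median order of T.  If f -> c in D, (c, d) is in T
   and d is not reached from f, then some missing edge fb, oriented (f, b), loses
   to cd.  Let B and Z be the sets of these b and d.  The argument of Havet and
   Thomasse applied to N+(f) U B and (N++(f) U Z) \ B gives the theorem, provided
   no b in B dominates in T a vertex that is outside both sets and not f.  This
   condition dictates how to orient the edges that are convenient both ways: from
   K to its complement on a path of positive length, and by the relation [rival]
   for an isolated edge. *)

Require Import Defs.
From mathcomp Require Import all_boot zify.
Set Implicit Arguments.
Unset Strict Implicit.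
Unset Printing Implicit Defensive.

(** * Median orders *)

Section MedianOrder.
Variables (V : eqType) (T : rel V).

Fixpoint forward_arcs (s : seq V) : nat :=
  if s is x :: s' then count (T x) s' + forward_arcs s' else 0.

Definition cross_arcs (s t : seq V) : nat := sumn [seq count (T x) t | x <- s].

Definition median (s : seq V) : Prop :=
  forall s', perm_eq s' s -> forward_arcs s' <= forward_arcs s.

Lemma forward_arcs_cat (s t : seq V) :
  forward_arcs (s ++ t) = forward_arcs s + forward_arcs t + cross_arcs s t.
Proof.
rewrite /cross_arcs; elim: s => [|x s IH] /=; first by rewrite add0n addn0.
by rewrite IH count_cat; lia.
Qed.

Lemma cross_arcs_perm (s s' t t' : seq V) :
  perm_eq s' s -> perm_eq t' t -> cross_arcs s' t' = cross_arcs s t.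
Proof.
move=> ps pt; rewrite /cross_arcs.
have -> : [seq count (T x) t' | x <- s'] = [seq count (T x) t | x <- s'].
  by apply: eq_map => x; apply/permP.
by apply: perm_sumn; apply: perm_map.
Qed.

(** Rearranging an initial segment does not change the number of arcs from it to the rest, so a
    better segment would give a better order. *)
Lemma median_catl (s t : seq V) : median (s ++ t) -> median s.
Proof.
move=> m s' ps; have /m : perm_eq (s' ++ t) (s ++ t) by rewrite perm_cat2r.
by rewrite !forward_arcs_cat (cross_arcs_perm ps (perm_refl t)); lia.
Qed.

Lemma median_catr (s t : seq V) : median (s ++ t) -> median t.
Proof.
move=> m t' pt; have /m : perm_eq (s ++ t') (s ++ t) by rewrite perm_cat2l.
by rewrite !forward_arcs_cat (cross_arcs_perm (perm_refl s) pt); lia.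
Qed.

(** Moving [x] to the front trades the arcs into [x] for the arcs out of [x] and affects nothing
    else. *)
Lemma median_feedback (s : seq V) (x : V) :
  median (rcons s x) -> count (T x) s <= count (T^~ x) s.
Proof.
move=> m; have /m : perm_eq (x :: s) (rcons s x) by rewrite perm_sym perm_rcons.
rewrite -cats1 forward_arcs_cat /= /cross_arcs.
have -> : sumn [seq count (T y) [:: x] | y <- s] = count (T^~ x) s.
  by elim: (s) => //= y s' ->; rewrite addn0.
by lia.
Qed.

Lemma exists_median (s : seq V) : exists2 s', perm_eq s' s & median s'.
Proof.
have [s' s'P s'max] : exists2 s', s' \in permutations s &
    forall t, t \in permutations s -> forward_arcs t <= forward_arcs s'.
  have : permutations s != [::].
    by apply/eqP => p0; have := mem_permutations s s; rewrite p0 perm_refl.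
  elim: (permutations s) => // a [|b l] IH _.
    by exists a; rewrite ?inE // => t; rewrite inE => /eqP->.
  have [//|c cin cmax] := IH.
  have [le_ac|lt_ca] := leqP (forward_arcs a) (forward_arcs c).
    exists c; first by rewrite inE cin orbT.
    by move=> t; rewrite inE => /predU1P[->|/cmax].
  exists a; first by rewrite inE eqxx.
  by move=> t; rewrite inE => /predU1P[->|/cmax/leq_trans] //; apply; apply: ltnW.
rewrite mem_permutations in s'P; exists s' => // t pt; apply: s'max.
by rewrite mem_permutations (perm_trans pt).
Qed.

(* The elements outside P and Q cut the order into intervals, in each of which P
   is at most as large as Q. *)
Lemma median_last_count (P Q : pred V) (s : seq V) (f : V) :
    (forall x y, x != y -> T x y || T y x) ->
    uniq (rcons s f) -> median (rcons s f) ->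
    {in s, forall x, P x -> ~~ Q x} ->
    {in s, forall x, P x -> ~~ T x f} ->
    {in s &, forall x y, P x -> ~~ P y -> ~~ Q y -> ~~ T x y} ->
  count P s <= count Q s.
Proof.
move=> Ttot; elim: {s}_.+1 {-2}s (ltnSn (size s)) => // n IH s.
move=> ltsn us ms PQ Pf Pbad.
(* In an interval closed by [x], the vertex [x] dominates all of [P], and all its in-neighbors lie
   in [Q]; the feedback inequality compares the two. *)
have interval (x : V) (u : seq V) : uniq (rcons u x) -> median (rcons u x) ->
    {in u, forall y, P y -> ~~ Q y} -> {in u, forall y, P y -> ~~ T y x} ->
    {in u, forall y, T y x -> P y || Q y} -> count P u <= count Q u.
  rewrite rcons_uniq => /andP[xu uu] mu PQu Pu goodu.
  have le1 : count P u <= count (T x) u.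
    rewrite -!size_filter; apply: uniq_leq_size; first exact: filter_uniq.
    move=> y; rewrite !mem_filter => /andP[Py yu]; rewrite yu andbT.
    have neq : x != y by apply: contraNneq xu => ->.
    by have := Ttot _ _ neq; rewrite (negPf (Pu _ yu Py)) orbF.
  have le2 : count (T^~ x) u <= count Q u.
    rewrite -!size_filter; apply: uniq_leq_size; first exact: filter_uniq.
    move=> y; rewrite !mem_filter => /andP[Ty yu]; rewrite yu andbT.
    have /orP[Py|//] := goodu _ yu Ty.
    by move: (Pu _ yu Py); rewrite Ty.
  exact: leq_trans le1 (leq_trans (median_feedback mu) le2).
have [bad|/hasPn nobad] := boolP (has (fun x => ~~ P x && ~~ Q x) s); last first.
  by apply: (interval f) => // y /nobad; rewrite -negb_or negbK.
case/split_find: bad ltsn us ms PQ Pf Pbad => x s1 s2 /andP[nPx nQx] nobad.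
move=> ltsn us ms PQ Pf Pbad.
have in1 y : y \in s1 -> y \in rcons s1 x ++ s2.
  by move=> ys; rewrite mem_cat mem_rcons inE ys orbT.
have in2 y : y \in s2 -> y \in rcons s1 x ++ s2.
  by move=> ys; rewrite mem_cat ys orbT.
have inx : x \in rcons s1 x ++ s2 by rewrite mem_cat mem_rcons inE eqxx.
rewrite rcons_cat in us ms; move: us; rewrite cat_uniq => /and3P[u1 _ u2].
have le1 : count P s1 <= count Q s1.
  apply: (interval x) => //; first exact: median_catl ms.
  - by move=> y ys; apply: PQ; apply: in1.
  - by move=> y ys Py; apply: Pbad => //; apply: in1.
  move=> y ys _; move/hasPn: nobad => /(_ y ys).
  by rewrite -negb_or negbK.
have le2 : count P s2 <= count Q s2.
  apply: IH => //.
  - by move: ltsn; rewrite size_cat size_rcons; lia.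
  - exact: median_catr ms.
  - by move=> y /in2; apply: PQ.
  - by move=> y /in2; apply: Pf.
  by move=> y z /in2 ys /in2 zs; apply: Pbad.
rewrite !count_cat -cats1 !count_cat /= (negPf nPx) (negPf nQx).
by rewrite !addn0 leq_add.
Qed.

End MedianOrder.

Lemma exists_feed (V : finType) (T : rel V) :
    0 < #|V| -> (forall x y, x != y -> T x y || T y x) ->
  exists f, forall P Q : {set V}, f \notin P -> [disjoint P & Q] ->
    {in P, forall x, ~~ T x f} ->
    (forall x y, x \in P -> y != f -> y \notin P -> y \notin Q -> ~~ T x y) ->
    #|P| <= #|Q|.
Proof.
move=> V0 Ttot; have [s ps ms] := exists_median T (enum V).
have us : uniq s by rewrite (perm_uniq ps) enum_uniq.
have ss x : x \in s by rewrite (perm_mem ps) mem_enum.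
case/lastP: s us ss ms {ps} => [_ ss|s f us ss ms].
  by have [x] := card_gt0P V0; have := ss x.
have sE x : (x \in s) = (x != f).
  move: us (ss x); rewrite rcons_uniq mem_rcons inE => /andP[fs _].
  by have [->|] := eqVneq x f; rewrite ?(negPf fs).
have us' : uniq s by move: us; rewrite rcons_uniq => /andP[].
have countE (P : {set V}) : count (mem P) s = #|P :\ f|.
  rewrite -size_filter -(card_uniqP _) ?filter_uniq //; apply: eq_card => x.
  by rewrite mem_filter !inE sE andbC.
exists f => P Q fP PQ Pf Pbad.
have: #|P :\ f| <= #|Q :\ f|.
  rewrite -!countE; apply: (median_last_count Ttot us ms).
  - by move=> x _ xP; rewrite /= (disjointFr PQ).
  - by move=> x _; apply: Pf.
  by move=> x y _; rewrite sE => yf xP; apply: Pbad.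
by rewrite (cardsD1 f P) (cardsD1 f Q) (negPf fP); lia.
Qed.

(** * Combs are split graphs *)

Lemma cycle_rel_sym (n : nat) : symmetric (@cycle_rel n).
Proof. by move=> i j; rewrite /cycle_rel /= orbC. Qed.

Lemma chair_rel_sym : symmetric chair_rel.
Proof. by move=> i j; rewrite /chair_rel /= orbC. Qed.

Lemma compl_rel_sym (I : finType) (h : rel I) : symmetric h -> symmetric (compl_rel h).
Proof. by move=> hs i j; rewrite /compl_rel /= hs eq_sym. Qed.

Ltac ord_cases := case=> [[|[|[|[|[|?]]]]] ?] //.

Section CombStructure.
Variables (V : finType) (G : sgraph V).
Local Notation M := (edge G).

Let Msym : symmetric M := @edge_sym V G.
Let Mirr : irreflexive M := @edge_irr V G.

Lemma edge_neq (x y : V) : M x y -> x != y.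
Proof. by apply: contraTneq => ->; rewrite Mirr. Qed.

(** The last hypothesis excludes isolated vertices in the pattern: a vertex is known to lie in
    [vertices G] through an edge at it. *)
Lemma has_induced_tuple (n : nat) (h : rel 'I_n) (t : n.-tuple V) :
    symmetric h -> irreflexive h -> uniq t ->
    (forall i j : 'I_n, i < j -> M (tnth t i) (tnth t j) = h i j) ->
  (forall i, exists j, h i j) -> has_induced G h.
Proof.
move=> hsym hirr ut th hi.
have thE i j : M (tnth t i) (tnth t j) = h i j.
  have [/th//|/th|/val_inj->] := ltngtP i j; last by rewrite Mirr hirr.
  by rewrite Msym hsym.
exists (tnth t); split => //; first exact/tuple_uniqP.
by move=> i; have [j hij] := hi i; apply: (@edge_vertices _ _ _ (tnth t j)); rewrite thE.
Qed.

Hypothesis hG : comb G.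

Lemma comb_C4 (a b c d : V) : a != c -> b != d ->
  M a b -> M b c -> M c d -> M a d -> ~~ M a c -> ~~ M b d -> False.
Proof.
case: hG => nC4 _ _ _ _ nac nbd ab bc cd ad /negbTE ac /negbTE bd; apply: nC4.
apply: (@has_induced_tuple _ _ [tuple a; b; c; d]).
- exact: cycle_rel_sym.
- by ord_cases.
- by rewrite /= !inE !negb_or nac nbd !edge_neq.
- by ord_cases; ord_cases; rewrite !(tnth_nth a).
- by ord_cases; [exists (inord 1)|exists (inord 2)|exists (inord 3)|exists (inord 0)];
    rewrite /compl_rel /cycle_rel /chair_rel /= -?val_eqE /= !inordK.
Qed.

Lemma comb_2K2 (a b c d : V) :
  a != c -> a != d -> b != c -> b != d ->
  M a b -> M c d -> ~~ M a c -> ~~ M a d -> ~~ M b c -> ~~ M b d -> False.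
Proof.
case: hG => _ n2K2 _ _ _ nac nad nbc nbd ab cd.
move=> /negbTE ac /negbTE ad /negbTE bc /negbTE bd; apply: n2K2.
(* Opposite vertices of the 4-cycle are adjacent in its complement, hence the interleaved order. *)
apply: (@has_induced_tuple _ _ [tuple a; c; b; d]).
- by apply: compl_rel_sym; apply: cycle_rel_sym.
- by ord_cases.
- by rewrite /= !inE !negb_or [c == b]eq_sym nac nad nbc nbd !edge_neq.
- by ord_cases; ord_cases; rewrite !(tnth_nth a) /= // Msym.
- by ord_cases; [exists (inord 2)|exists (inord 3)|exists (inord 0)|exists (inord 1)];
    rewrite /compl_rel /cycle_rel /chair_rel /= -?val_eqE /= !inordK.
Qed.

Lemma comb_C5 (a b c d e : V) :
  a != c -> a != d -> b != d -> b != e -> c != e ->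
  M a b -> M b c -> M c d -> M d e -> M a e ->
  ~~ M a c -> ~~ M a d -> ~~ M b d -> ~~ M b e -> ~~ M c e -> False.
Proof.
case: hG => _ _ nC5 _ _ nac nad nbd nbe nce ab bc cd de ae.
move=> /negbTE ac /negbTE ad /negbTE bd /negbTE be /negbTE ce; apply: nC5.
apply: (@has_induced_tuple _ _ [tuple a; b; c; d; e]).
- exact: cycle_rel_sym.
- by ord_cases.
- by rewrite /= !inE !negb_or nac nad nbd nbe nce !edge_neq.
- by ord_cases; ord_cases; rewrite !(tnth_nth a).
- by ord_cases; [exists (inord 1)|exists (inord 2)|exists (inord 3)|exists (inord 4)
    |exists (inord 0)]; rewrite /compl_rel /cycle_rel /chair_rel /= -?val_eqE /= !inordK.
Qed.

Lemma comb_chair (x y z t v : V) :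
  x != z -> x != t -> x != v -> y != t -> y != v -> t != v ->
  M x y -> M y z -> M z t -> M z v ->
  ~~ M x z -> ~~ M x t -> ~~ M x v -> ~~ M y t -> ~~ M y v -> ~~ M t v -> False.
Proof.
case: hG => _ _ _ nch _ nxz nxt nxv nyt nyv ntv xy yz zt zv.
move=> /negbTE xz /negbTE xt /negbTE xv /negbTE yt /negbTE yv /negbTE tv; apply: nch.
apply: (@has_induced_tuple _ _ [tuple x; y; z; t; v]).
- exact: chair_rel_sym.
- by ord_cases.
- by rewrite /= !inE !negb_or nxz nxt nxv nyt nyv ntv !edge_neq.
- by ord_cases; ord_cases; rewrite !(tnth_nth x).
- by ord_cases; [exists (inord 1)|exists (inord 2)|exists (inord 3)|exists (inord 2)
    |exists (inord 2)]; rewrite /chair_rel /= !inordK.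
Qed.

Lemma comb_cochair (x y z t v : V) :
  x != y -> y != z -> z != t -> z != v ->
  M x z -> M x t -> M x v -> M y t -> M y v -> M t v ->
  ~~ M x y -> ~~ M y z -> ~~ M z t -> ~~ M z v -> False.
Proof.
case: hG => _ _ _ _ nch nxy nyz nzt nzv xz xt xv yt yv tv.
move=> /negbTE xy /negbTE yz /negbTE zt /negbTE zv; apply: nch.
apply: (@has_induced_tuple _ _ [tuple x; y; z; t; v]).
- by apply: compl_rel_sym; apply: chair_rel_sym.
- by ord_cases.
- by rewrite /= !inE !negb_or nxy nyz nzt nzv !edge_neq.
- by ord_cases; ord_cases; rewrite !(tnth_nth x).
- by ord_cases; [exists (inord 2)|exists (inord 3)|exists (inord 0)|exists (inord 4)
    |exists (inord 3)]; rewrite /compl_rel /cycle_rel /chair_rel /= -?val_eqE /= !inordK.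
Qed.

(* Maximizing this weight favors large cliques, then large degree sums. *)
Let weight (K : {set V}) := \sum_(x in K) (#|V| + #|[set y | M x y]|).
Let clique (K : {set V}) := [forall x in K, forall y in K, (x != y) ==> M x y].

(** A clique of maximal [weight] works. If x and y outside it were adjacent, the absence of C4 would
    make their non-neighborhoods in [K] nested; then a heavier clique or an induced 2K2, C4 or C5
    appears. *)
Lemma comb_split : exists K : {set V},
  {in K &, forall x y, x != y -> M x y} /\
  (forall x y, x \notin K -> y \notin K -> ~~ M x y).
Proof.
have clique0 : clique set0 by apply/forall_inP => x; rewrite inE.
case: (@arg_maxnP _ set0 clique weight clique0) => K cK maxK.
have cliqueP (C : {set V}) :
    reflect {in C &, forall x y, x != y -> M x y} (clique C).
  apply: (iffP forall_inP) => [h x y xC yC|h x xC].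
    by move/forall_inP: (h x xC) => /(_ y yC) /implyP.
  by apply/forall_inP => y yC; apply/implyP; apply: h.
have {}cK := cliqueP _ cK.
have weightU (C : {set V}) x : x \notin C ->
    weight (x |: C) = #|V| + #|[set y | M x y]| + weight C.
  by move=> xC; rewrite /weight big_setU1.
have weightD (C : {set V}) x : x \in C ->
    weight C = #|V| + #|[set y | M x y]| + weight (C :\ x).
  by move=> xC; rewrite /weight (big_setD1 x).
have cliqueU (C : {set V}) x : {in C &, forall x y, x != y -> M x y} ->
    {in C, forall y, M x y} -> clique (x |: C).
  move=> cC xC; apply/cliqueP => y z; rewrite !inE.
  move=> /predU1P[->|yC] /predU1P[->|zC]; first by rewrite eqxx.
  - by move=> _; apply: xC.
  - by move=> _; rewrite Msym; apply: xC.
  exact: cC.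
have Vgt0 (x : V) : 0 < #|V| by apply/card_gt0P; exists x.
(* Exchanging [u] for [x] gives a clique again. *)
have max1 (x u : V) : x \notin K -> u \in K -> {in K, forall w, ~~ M x w -> w = u} ->
    #|[set y | M x y]| <= #|[set y | M u y]|.
  move=> xK uK xu; have := maxK (x |: K :\ u).
  rewrite weightU ?inE ?(negPf xK) ?andbF // (weightD K u uK) cliqueU.
  - by lia.
  - by move=> y z /setD1P[_ yK] /setD1P[_ zK]; apply: cK.
  by move=> y /setD1P[yu yK]; apply: contraNT yu => /xu -> //.
(* Exchanging [u] for both [x] and [y] gains [#|V|] plus two positive degrees and loses a degree of
   at most [#|V|]. *)
have max2 (x y u : V) : x \notin K -> y \notin K -> M x y -> u \in K ->
    {in K, forall w, ~~ M x w -> w = u} -> {in K, forall w, ~~ M y w -> w = u} -> False.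
  move=> xK yK xy uK xu yu; have := maxK (x |: (y |: K :\ u)).
  rewrite weightU; last by rewrite !inE (negPf xK) (negPf (edge_neq xy)) andbF.
  rewrite weightU ?inE ?(negPf yK) ?andbF // (weightD K u uK) cliqueU.
  - have := max1 _ _ xK uK xu; have := Vgt0 x; have : #|[set z | M u z]| <= #|V|.
      exact: max_card.
    have : 0 < #|[set z | M x z]| by apply/card_gt0P; exists y; rewrite inE.
    by have : 0 < #|[set z | M y z]|; [apply/card_gt0P; exists x; rewrite inE Msym|lia].
  - apply/cliqueP; apply: cliqueU => [v w /setD1P[_ vK] /setD1P[_ wK]|v /setD1P[vu vK]].
      exact: cK.
    by apply: contraNT vu => /yu -> //.
  move=> v; rewrite in_setU1 => /predU1P[->//|/setD1P[vu vK]].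
  by apply: contraNT vu => /xu -> //.
have neqK (x y : V) : x \notin K -> y \in K -> x != y.
  by move=> xK; apply: contraTneq => <-.
have nested (x y : V) : x \notin K -> y \notin K -> M x y ->
    {in K, forall u, ~~ M x u -> ~~ M y u} -> False.
  move=> xK yK xy sub.
  have [/forall_inP xall|] := boolP [forall u in K, M x u].
    have := maxK (x |: K); rewrite weightU // cliqueU //.
    by have := Vgt0 x; lia.
  rewrite negb_forall_in => /exists_inP[u uK xu].
  have yu := sub u uK xu.
  have uniq_u : {in K, forall w, ~~ M x w -> w = u}.
    move=> w wK xw; apply/eqP/negPn/negP => wu.
    by apply: (@comb_2K2 x y w u); auto.
  have [/forall_inP yall|] := boolP [forall w in K, (w != u) ==> M y w].
    apply: (max2 x y u) => // w wK yw; apply/eqP/negPn/negP => wu.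
    by have := yall w wK; rewrite wu (negPf yw).
  rewrite negb_forall_in => /exists_inP[w wK]; rewrite negb_imply => /andP[wu yw].
  have xw : M x w by apply: contraNT wu => /uniq_u -> //.
  (* By [max1] the degree of [x] is at most that of [u]; as [y] is adjacent to [x] but not to [u],
     some [z] is adjacent to [u] but not to [x]. *)
  have [z uz xz] : exists2 z, M u z & ~~ M x z.
    case: (pickP [pred z | M u z && ~~ M x z]) => [z /= /andP[uz xz]|h]; first by exists z.
    have := max1 _ _ xK uK uniq_u; rewrite leqNgt => /negP[].
    apply: proper_card; apply/properP; split.
      by apply/subsetP => z; have := h z; rewrite !inE /= => /[swap] -> /negbFE.
    by exists y; rewrite !inE // Msym.
  have zK : z \notin K.
    by apply/negP => zK; move: uz; rewrite (uniq_u z zK xz) Mirr.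
  have nxz : x != z by apply: contraNneq xu => ->; rewrite Msym.
  have nyz : y != z by apply: contraNneq yu => ->; rewrite Msym.
  have yz : M y z.
    apply/negPn/negP => yz.
    by apply: (@comb_2K2 x y u z); auto.
  have [zw|zw] := boolP (M z w).
    by apply: (@comb_C4 x y z w); auto.
  by apply: (@comb_C5 x y z u w); auto; [rewrite Msym|apply: cK; rewrite // eq_sym].
exists K; split => // x y xK yK; apply/negP => xy.
have [sub|] := boolP [forall u in K, ~~ M x u ==> ~~ M y u].
  apply: (nested x y) => // u uK.
  by move/forall_inP: sub => /(_ u uK) /implyP.
rewrite negb_forall_in => /exists_inP[u uK]; rewrite negb_imply negbK => /andP[xu yu].
apply: (nested y x) => //; first by rewrite Msym.
move=> w wK yw; apply/negP => xw.
have uw : u != w by apply: contraNneq xu => ->.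
apply: (@comb_C4 w x y u); auto; first by rewrite eq_sym neqK.
- by rewrite Msym.
- by apply: cK; rewrite // eq_sym.
by rewrite Msym.
Qed.

(** If x and y were distinct, the five vertices would induce a chair with center [p] when [p] and
    [q] are in [K], and a co-chair otherwise. *)
Lemma comb_neighborhoods (K : {set V}) (p q x y z : V) :
    {in K &, forall x y, x != y -> M x y} ->
    (forall x y, x \notin K -> y \notin K -> ~~ M x y) ->
    (p \in K) = (q \in K) -> M p x -> M p y -> M q z ->
    ~~ M q x -> ~~ M q y -> ~~ M p z -> x != q -> y != q -> z != p ->
  x = y.
Proof.
move=> KK SS pqK px py qz qx qy pz xq yq zp; apply/eqP/negPn/negP => xy.
have pq : p != q by apply: contraNneq qx => <-.
have zx : z != x by apply: contraNneq qx => <-.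
have zy : z != y by apply: contraNneq qy => <-.
have [pK|pK] := boolP (p \in K).
  have out u : ~~ M q u -> u != q -> u \notin K.
    by move=> qu uq; apply: contra qu => uK; apply: KK; rewrite -?pqK // eq_sym.
  have zK : z \notin K by apply: contra pz => zK; apply: KK; rewrite // eq_sym.
  have [xK yK] := (out x qx xq, out y qy yq).
  apply: (@comb_chair z q p x y); auto; try by rewrite Msym.
  - by rewrite eq_sym.
  - by rewrite eq_sym.
  by apply: KK; rewrite -?pqK // eq_sym.
have qK : q \notin K by rewrite -pqK.
have inn r u : r \notin K -> M r u -> u \in K.
  by move=> rK; apply: contraLR; apply: SS.
rewrite eq_sym in xq; rewrite eq_sym in yq.
apply: (@comb_cochair z p q x y); auto.
- by rewrite Msym.
- by apply: KK; rewrite ?(inn q z) ?(inn p x).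
- by apply: KK; rewrite ?(inn q z) ?(inn p y).
- by apply: KK; rewrite ?(inn p x) ?(inn p y).
- by rewrite Msym.
Qed.

End CombStructure.

(** * The losing relation on missing edges *)

Section MissingSplit.
Variables (V : finType) (D : rel V) (K : {set V}).
Local Notation M := (missing_edge D).

Definition adjacent : rel V := [rel x y | D x y || D y x].
Local Notation N := adjacent.

Definition reach : rel V := [rel u v | D u v || [exists w, D u w && D w v]].
Local Notation R := reach.

Definition loses (a b c d : V) : bool :=
  [&& M a b, M c d, D a c, D b d, ~~ R a d & ~~ R b c].
Local Notation L := loses.

Definition convenient (a b : V) : bool := [forall v, D v a ==> R v b].

Hypotheses (Dirr : irreflexive D) (Dasym : antisymmetric D).
Hypothesis KK : {in K &, forall x y, x != y -> M x y}.
Hypothesis SS : forall x y, x \notin K -> y \notin K -> ~~ M x y.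
(** In terms of the missing graph, [N q x] says that [x] is neither [q] nor adjacent to [q]. Thus if
    [q] has a private neighbor against [p], then [p] has at most one against [q]. *)
Hypothesis nb : forall p q x y z, (p \in K) = (q \in K) ->
  M p x -> M p y -> M q z -> N q x -> N q y -> N p z -> x = y.

Lemma arc_neq (x y : V) : D x y -> x != y.
Proof. by apply: contraTneq => ->; rewrite Dirr. Qed.

Lemma arcN (x y : V) : D x y -> ~~ D y x.
Proof.
move=> xy; apply/negP => yx; move: (arc_neq xy).
by rewrite (@Dasym x y) ?eqxx // xy yx.
Qed.

Lemma missC (x y : V) : M x y -> M y x.
Proof. by rewrite /missing_edge /= eq_sym andbA andbAC -andbA. Qed.

Lemma miss_neq (x y : V) : M x y -> x != y.
Proof. by case/and3P. Qed.

Lemma adjC (x y : V) : N x y -> N y x.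
Proof. by rewrite /adjacent /= orbC. Qed.

Lemma arc_adj (x y : V) : D x y -> N x y.
Proof. by rewrite /adjacent /= => ->. Qed.

Lemma miss_adj (x y : V) : M x y -> N x y -> False.
Proof. by case/and3P=> _ /negPf xy /negPf yx; rewrite /adjacent /= xy yx. Qed.

Lemma missP (x y : V) : x != y -> M x y \/ N x y.
Proof.
by rewrite /missing_edge /adjacent /= => ->; case: (D x y) (D y x) => [] []; auto.
Qed.

Lemma adjP (x y : V) : x != y -> [\/ D x y, D y x | M x y].
Proof.
move/missP => [|/orP[]]; [exact: Or33|exact: Or31|exact: Or32].
Qed.

Lemma reachP (u v : V) : reflect (D u v \/ exists2 w, D u w & D w v) (R u v).
Proof.
apply: (iffP orP) => -[|]; auto.
  by case/existsP => w /andP[]; right; exists w.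
by case=> w uw wv; right; apply/existsP; exists w; rewrite uw.
Qed.

Lemma reachN_arc (u v : V) : ~~ R u v -> ~~ D u v.
Proof. by case/norP. Qed.

Lemma reachN_path (u w v : V) : ~~ R u v -> D u w -> D w v -> False.
Proof. by move/reachP => nR uw wv; apply: nR; right; exists w. Qed.

Lemma convenientP (a b : V) : reflect (forall v, D v a -> R v b) (convenient a b).
Proof. by apply: (iffP forallP) => h v; [apply/implyP|apply/implyP/h]. Qed.

Lemma convenientN (a b : V) : ~~ convenient a b -> exists2 v, D v a & ~~ R v b.
Proof.
by rewrite negb_forall => /existsP[v]; rewrite negb_imply => /andP[]; exists v.
Qed.

Lemma miss_outK (x y : V) : M x y -> x \notin K -> y \in K.
Proof. by move=> xy xK; apply: contraLR xy; apply: SS. Qed.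

Lemma adj_neq (x y : V) : N x y -> x != y.
Proof. by case/orP => /arc_neq //; rewrite eq_sym. Qed.

Lemma adj_inK (x y : V) : N x y -> x \in K -> y \notin K.
Proof. by move=> xy xK; apply/negP => /(KK xK) /(_ (adj_neq xy)) /miss_adj; apply. Qed.

Lemma adj_outK (x y : V) : x != y -> x \notin K -> y \notin K -> N x y.
Proof. by move=> /missP[xy|//] xK yK; move: (SS xK yK); rewrite xy. Qed.

Lemma neq_inK (x y : V) : x \in K -> y \notin K -> x != y.
Proof. by move=> xK; apply: contraNneq => <-. Qed.

Lemma losesE (a b c d : V) : L a b c d ->
  [/\ M a b, M c d, D a c & D b d] /\ (~~ R a d /\ ~~ R b c).
Proof. by case/and5P => ? ? ? ? /andP[]. Qed.

Lemma loses_sym (a b c d : V) : L a b c d -> L b a d c.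
Proof.
case/losesE => [[ab cd ac bd] [ad bc]].
by rewrite /loses ac bd ad bc (missC ab) (missC cd).
Qed.

(** No missing edge lies outside [K] and no arc inside it, which fixes the sides; then [a] and [d]
    are joined by an arc, and it cannot start at [a]. *)
Lemma loses_out (a b c d : V) : L a b c d -> a \notin K ->
  [/\ b \in K, c \in K, d \notin K, D d a & M b c].
Proof.
case/losesE => [[ab cd ac bd] [ad bc]] aK; have bK := miss_outK ab aK.
have dK := adj_inK (arc_adj bd) bK; have cK := miss_outK (missC cd) dK.
have nad : a != d.
  by apply/eqP => ead; rewrite -ead in cd; apply: (miss_adj (missC cd) (arc_adj ac)).
have nbc : b != c.
  by apply/eqP => ebc; rewrite ebc in ab; apply: (miss_adj ab (arc_adj ac)).
split => //; last exact: KK.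
by case/orP: (adj_outK nad aK dK) => // /(negP (reachN_arc ad)).
Qed.

Section Losing.
Variables a b c d : V.
Hypothesis abcd : L a b c d.

Lemma loses_side : (b \in K) = (c \in K) /\ (a \in K) = (d \in K).
Proof.
have [aK|aK] := boolP (a \in K); last first.
  by have [-> -> /negPf-> _ _] := loses_out abcd aK.
have [bK|bK] := boolP (b \in K); last first.
  by have [_ -> /negPf-> _ _] := loses_out (loses_sym abcd) bK.
(* With [a] and [b] both in [K], their out-neighbors [c] and [d] would lie outside [K], where no
   edge is missing. *)
have [[ab cd ac bd] _] := losesE abcd.
by case: (miss_adj cd); apply: adj_outK; [exact: miss_neq| |];
  [apply: adj_inK aK; apply: arc_adj|apply: adj_inK bK; apply: arc_adj].
Qed.

Lemma loses_cross : (b \in K) = (a \notin K).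
Proof.
have [aK|aK] := boolP (a \in K); last by have [->] := loses_out abcd aK.
apply/negP => bK; have [[ab cd ac bd] _] := losesE abcd.
have [bc _] := loses_side.
by case/negP: (adj_inK (arc_adj ac) aK); rewrite -bc.
Qed.

(** The vertices [b] and [c] are on the same side and each has a private neighbor in the missing
    graph, [a] and [d]; by [nb] these are the only ones. *)
Lemma loses_nb1 (x : V) : M b x -> N c x -> x = a.
Proof.
move=> bx cx; have [[ab cd ac bd] _] := losesE abcd.
by apply: (nb (proj1 loses_side) bx (missC ab) cd cx); [exact/adjC/arc_adj|exact/arc_adj].
Qed.

Lemma loses_nb2 (x : V) : M c x -> N b x -> x = d.
Proof.
move=> bx cx; have [[ab cd ac bd] _] := losesE abcd.
by apply: (nb (esym (proj1 loses_side)) bx cd (missC ab) cx); [exact/arc_adj|exact/adjC/arc_adj].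
Qed.

End Losing.

(** An arc between [v] and [q] would make [b] reached from [v] or [a] reached from [q]. So [v] is a
    private neighbor of [q] against [a], as is [p]. *)
Lemma loses_prev (p q a b v : V) : L p q a b -> D v a -> ~~ R v b -> v = p.
Proof.
move=> pqab va vb; have [[_ _ pa qb] [_ qa]] := losesE pqab.
have vq : v != q by apply: contraTneq va => ->; apply: reachN_arc.
have [v_q|qv|v_q] := adjP vq.
- by case: (reachN_path vb v_q qb).
- by case: (reachN_path qa qv va).
by apply: (loses_nb1 pqab); [apply: missC|apply/adjC/arc_adj].
Qed.

Lemma loses_inj (p q p' q' a b : V) : L p q a b -> L p' q' a b -> p' = p /\ q' = q.
Proof.
move=> pqab pqab'; have [[_ _ pa qb] [pb qa]] := losesE pqab'.
by rewrite (loses_prev pqab pa pb) (loses_prev (loses_sym pqab) qb qa).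
Qed.

(** The pair [c'], [d] can only be a missing edge, so [d] is the private neighbor of [c'] against
    [b]. This later bounds the size of Z by that of B. *)
Lemma loses_target (a b c d c' d' : V) : L a b c d -> L a b c' d' -> d' = d.
Proof.
move=> abcd abcd'; have [[ab cd ac bd] [ad bc]] := losesE abcd.
have [[_ cd' ac' bd'] [ad' bc']] := losesE abcd'.
have c'd : c' != d by apply: contraTneq ac' => ->; apply: reachN_arc.
have [c'_d|dc'|c'_d] := adjP c'd.
- by case: (reachN_path ad ac' c'_d).
- by case: (reachN_path bc' bd dc').
by apply: esym; apply: (loses_nb2 abcd'); [|apply: arc_adj].
Qed.

(** Witnesses against the two orientations form a missing edge that loses to [ab]. *)
Lemma unbeaten_convenient (a b : V) : M a b -> (forall p q, ~~ L p q a b) ->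
  convenient a b || convenient b a.
Proof.
move=> ab nL; apply/negPn/negP; rewrite negb_or.
move=> /andP[/convenientN[p pa pb] /convenientN[q qb qa]].
have pq : p != q by apply: contraTneq pa => ->; apply: reachN_arc.
suff pq_miss : M p q by move: (nL p q); rewrite /loses pq_miss ab pa qb pb qa.
have [p_q|qp|//] := adjP pq.
  by case: (reachN_path pb p_q qb).
by case: (reachN_path qa qp pa).
Qed.

(** Suppose that [pq] loses to [sk]. Comparing [s] with [q] shows that [qv] is missing and [ql] is
    not; then [k] and [l] are two private neighbors of [x] against [q], which has [v] against
    [x]. *)
Lemma sun_unbeaten (s k v x l p q : V) : s \notin K -> x \notin K -> l \in K ->
  M s k -> M s v -> D s l -> M x k -> M x l -> N x v -> ~~ L p q s k.
Proof.
move=> sK xK lK sk sv sl xk xl xv; apply/negP => pqsk.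
have kK := miss_outK sk sK; have vK := miss_outK sv sK.
have [[pq _ ps qk] _] := losesE pqsk.
have pK : p \in K by have [_ ->] := loses_side pqsk.
have qK : q \notin K by have [-> _] := loses_side pqsk.
have sides (y z : V) : y \notin K -> z \notin K -> (y \in K) = (z \in K).
  by move=> /negPf-> /negPf->.
have kl : k != l by apply/eqP => ekl; case: (miss_adj sk); rewrite ekl arc_adj.
have kv : k != v by apply/eqP => ekv; case: (miss_adj xk); rewrite ekv.
have pl : p != l by apply: contraTneq ps => ->; apply: arcN.
have [q_v|q_v] := missP (neq_inK vK qK); last first.
  move/eqP: kv; apply; apply: (nb (sides _ _ sK qK) sk sv (missC pq)).
  - exact/arc_adj.
  - exact/adjC.
  exact/adjC/arc_adj.
have [q_l|q_l] := missP (neq_inK lK qK).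
  move/eqP: pl; apply; apply: (nb (sides _ _ qK sK) (missC pq) (missC q_l) sk).
  - exact/adjC/arc_adj.
  - exact/arc_adj.
  exact/arc_adj.
move/eqP: kl; apply; apply: (nb (sides _ _ xK qK) xk xl (missC q_v)) => //.
- exact/arc_adj.
exact/adjC.
Qed.

(* The obstruction to orienting an isolated edge as (a, b): if f were the feed
   vertex, then b would be reached from f in T but not in D. *)
Definition rivals (a b : V) (T : rel V) : Prop :=
  exists f c d, [/\ f \notin K, T f a, L f a c d & ~~ R f b].

(** * The feed vertex *)

Section Orientation.
Variable T : rel V.
(** Requirements on the completion. By [Tbad], an orientation fails at [f] only if it is inherited
    from an edge at [f]. By [Tpref], the first edge of a path of positive length leaves the
    complement of [K] only when forced to. [Ttie] and [TtieK] concern isolated edges convenient both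
    ways. *)
Hypotheses (Ttotal : forall x y, x != y -> T x y = ~~ T y x)
           (Tarc : forall x y, D x y -> T x y).
Hypothesis Tbad : forall f c d, M c d -> T c d -> D f c -> ~~ R f d ->
  exists2 b, L f b c d & T f b.
Hypothesis Tpref : forall s k c d, s \notin K -> L s k c d -> T s k ->
  (forall p q, ~~ L p q s k) -> ~~ convenient k s.
Hypothesis Ttie : forall a b, M a b ->
  (forall p q, ~~ L p q a b) -> (forall p q, ~~ L a b p q) ->
  convenient a b -> convenient b a -> T a b -> rivals a b T -> rivals b a T.
Hypothesis TtieK : forall s k, s \notin K -> M s k ->
  (forall p q, ~~ L p q s k) -> (forall p q, ~~ L s k p q) ->
  convenient s k -> convenient k s -> T s k -> rivals k s T.

Lemma T_convenient (a b : V) : M a b -> T a b -> (forall p q, ~~ L p q a b) -> convenient a b.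
Proof.
move=> ab Tab nL; apply/convenientP => v va; apply/negPn/negP => vb.
by have [q vq _] := Tbad ab Tab va vb; move: (nL v q); rewrite vq.
Qed.

Section Feed.
(** The configuration to be refuted: [b] in B dominates [x], while [nB] and [nZ] keep [x] out of B
    and Z. *)
Variables (f b c d x : V).
Hypotheses (fbcd : L f b c d) (Tfb : T f b) (Tbx : T b x) (xf : x != f) (xb : x != b).
Hypotheses (fx : ~~ R f x).
Hypothesis (nB : forall c' d', L f x c' d' -> ~~ T f x).
Hypothesis (nZ : forall b' c', L f b' c' x -> ~~ T f b').

Lemma feed_missing : M b x /\ M c x.
Proof.
have [[fb cd fc bd] [fd b_c]] := losesE fbcd.
have xc : x != c by apply: contraTneq fc => <-; apply: reachN_arc.
have xd : x != d.
  by apply: contraTneq Tfb => exd; apply: (nZ (c' := c)); rewrite exd.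
have b_x : M b x.
  have [bx|/Tarc|//] := adjP (contra_neq esym xb); last by rewrite Ttotal // Tbx.
  have [xc'|cx|x_c] := adjP xc.
  - by case: (reachN_path b_c bx xc').
  - by case: (reachN_path fx fc cx).
  by case/eqP: xd; apply: (loses_nb2 fbcd); [apply: missC|apply: arc_adj].
split=> //; have [/missC//|xc'] := missP xc.
by case/eqP: xf; apply: (loses_nb1 fbcd) => //; apply: adjC.
Qed.

Lemma feed_unreach (v : V) : D v x -> ~~ R v b -> N v f -> exists q, L v q f b.
Proof.
move=> vx vb /orP[vf|fv]; last by case: (reachN_path fx fv vx).
have [[fb _ _ _] _] := losesE fbcd.
by have [q vq _] := Tbad fb Tfb vf vb; exists q.
Qed.

(* If b -> x in T, then b and x are joined by a missing edge convenient both ways,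
   except in a 3-sun, where (f, v) is the orientation in T of another edge and
   puts x in Z; the tie rules then exclude (b, x). *)
Lemma feed_outside : f \notin K -> False.
Proof.
move=> fK; have [bK cK dK df bc] := loses_out fbcd fK.
have [[fb cd fc bd] [fd b_c]] := losesE fbcd.
have [bx cx] := feed_missing.
have KE (y z : V) : y \in K -> z \in K -> (y \in K) = (z \in K) by move=> -> ->.
(* An edge [pq] losing to [bx] would have p = d, against the arc from [b] to [d]. *)
have nbeat p q : ~~ L p q b x.
  apply/negP => pqbx; have [[pq _ pb qx] _] := losesE pqbx.
  have pK : p \notin K by apply: adj_inK bK; apply/adjC/arc_adj.
  have [qK _ xK xp qb] := loses_out pqbx pK.
  have qf : M q f.
    have [//|qf] := missP (neq_inK qK fK).
    by case/eqP: xf; apply/esym/(loses_nb2 pqbx); [apply: missC|].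
  have ecp : p = d.
    have [c_p|c_p] := missP (neq_inK cK pK).
      by apply: (loses_nb2 fbcd); [|apply/adjC/arc_adj].
    have epf : p = f.
      by apply: (nb (KE q c qK cK) (missC pq) qf cx c_p); [exact/adjC/arc_adj|exact/arc_adj].
    by case: (miss_adj fb); rewrite -epf arc_adj.
  by move: (arcN bd); rewrite -ecp pb.
have conv_bx := T_convenient bx Tbx nbeat.
have fb_unbeaten v : M f v -> N x v -> x \notin K -> forall p q, ~~ L p q f b.
  move=> fv xv xK p q.
  exact: (sun_unbeaten p q fK xK cK fb fv fc (missC bx) (missC cx) xv).
have conv_xb : convenient x b.
  apply/negPn/negP => /convenientN[v vx vb].
  have vf : v != f by apply: contraTneq vx => ->; apply: reachN_arc.
  have [v_f|v_f] := missP vf; last first.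
    have [q vqfb] := feed_unreach vx vb v_f.
    have [[vq _ _ qb] _] := losesE vqfb.
    have vK : v \in K by have [_ ->] := loses_side vqfb.
    have xK := adj_inK (arc_adj vx) vK.
    case/eqP: xf; apply: (nb (KE b v bK vK) bx (missC fb) vq).
    - exact: arc_adj.
    - exact: v_f.
    exact/adjC/arc_adj.
  have vK := miss_outK (missC v_f) fK.
  have xK := adj_inK (arc_adj vx) vK.
  have v_c : ~~ R v c.
    apply/negP => /reachP[vc|[w vw wc]].
      by case/negP: (adj_inK (arc_adj vc) vK).
    have wK : w \notin K by apply: adj_inK vK; exact: arc_adj.
    have [b_w|/orP[bw|wb]] := missP (neq_inK bK wK).
    - have ewf : w = f by apply: (loses_nb1 fbcd) => //; apply/adjC/arc_adj.
      by case: (miss_adj v_f); rewrite -ewf arc_adj.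
    - exact: (reachN_path b_c bw wc).
    exact: (reachN_path vb vw wb).
  (* As [x] is not in Z, the edge [fv] is oriented (v, f). By [Tpref], (b, f) is not convenient, and
     the witness [u] is incompatible with every relation to [v]. *)
  have fvcx : L f v c x by rewrite /loses (missC v_f) cx fc vx fx v_c.
  have Tvf : T v f by rewrite Ttotal // (negPf (nZ fvcx)).
  have [u ub uf] := convenientN (Tpref fK fbcd Tfb
    (fb_unbeaten v (missC v_f) (adjC (arc_adj vx)) xK)).
  have uv : u != v by apply: contraTneq (bK) => euv; apply: adj_inK vK; rewrite -euv arc_adj.
  have vb' : v != b by apply: contraTneq vx => ->; apply/negP => /arc_adj; apply: miss_adj.
  have dv : M v d.
    have [//|vd] := missP (neq_inK vK dK).
    by case/eqP: vb'; apply: (loses_nb1 (loses_sym fbcd)); [apply: missC|apply: adjC].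
  have [u_v|vu|u_v] := adjP uv.
  - have [q uqvf _] := Tbad v_f Tvf u_v uf.
    apply: (negP (sun_unbeaten q u fK dK cK (missC v_f) fb fc (missC dv) (missC cd) _)).
      exact/adjC/arc_adj.
    exact: loses_sym.
  - exact: (reachN_path vb vu ub).
  have eud : u = d.
    by apply: (nb (KE v b vK bK) (missC u_v) dv bx);
      [exact/adjC/arc_adj|exact/arc_adj|exact/arc_adj].
  by move: (arcN bd); rewrite -eud ub.
have [xK|xK] := boolP (x \in K).
  have isolated p q : ~~ L b x p q.
    by apply/negP => /loses_cross; rewrite bK xK.
  (* The rule [Ttie] answers the rival [f] by a rival [f'] of (x, b). An arc joins the two, and in
     either direction [Tbad] yields a losing edge with ends on the wrong sides. *)
  have rbx : rivals b x T by exists f, c, d.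
  have [f' [c' [d' [f'K Tf'x f'xcd f'b]]]] := Ttie bx nbeat isolated conv_bx conv_xb Tbx rbx.
  have f'f : f' != f.
    apply/eqP => ef'; rewrite ef' in f'xcd Tf'x.
    by move: (nB f'xcd); rewrite Tf'x.
  have [[f'x _ _ _] _] := losesE f'xcd.
  have [f'_f|ff'|f'_f] := adjP f'f.
  - have [q f'qfb _] := Tbad fb Tfb f'_f f'b.
    by move: (loses_side f'qfb) => [_]; rewrite bK (negPf f'K).
  - have [q fqf'x _] := Tbad f'x Tf'x ff' fx.
    by move: (loses_side fqf'x) => [_]; rewrite xK (negPf fK).
  by case: (miss_adj f'_f); apply: adj_outK.
have xf' : D x f.
  have /orP[//|fx'] : N x f by apply: adj_outK.
  by case/negP: (reachN_arc fx).
have [/forallP isolated|] := boolP [forall e : V * V, ~~ L b x e.1 e.2].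
  have rbx : rivals b x T by exists f, c, d.
  have isol p q : ~~ L b x p q by exact: (isolated (p, q)).
  have [f' [c' [d' [f'K _ f'xcd _]]]] := Ttie bx nbeat isol conv_bx conv_xb Tbx rbx.
  have [[f'x _ _ _] _] := losesE f'xcd.
  by case/negP: (SS f'K xK).
(* Now [bx] starts a path of positive length. The vertex [z] makes [fb] unbeaten, so (b, f) is not
   convenient by [Tpref], and a witness [v] reaches [x] but not [f]. *)
rewrite negb_forall => /existsP[[y z]]; rewrite negbK /= => bxyz.
have [_ zK _ _ bz] := loses_out (loses_sym bxyz) xK.
have [[_ yz _ xz] _] := losesE bxyz.
have fz : M f z.
  have [/missC//|zf] := missP (neq_inK zK fK).
  by case/eqP: xf; apply/esym/(loses_nb1 (loses_sym bxyz)); [apply: missC|].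
have [v vb vf] := convenientN (Tpref fK fbcd Tfb (fb_unbeaten z fz (arc_adj xz) xK)).
have /reachP[vx|[w vw wx]] := convenientP _ _ conv_bx v vb.
  exact: (reachN_path vf vx xf').
have wf : w != f by apply: contraTneq wx => ->; apply: reachN_arc.
have [wf'|fw|w_f] := adjP wf.
- exact: (reachN_path vf vw wf').
- exact: (reachN_path fx fw wx).
have ewz : w = z.
  have sides : (f \in K) = (x \in K) by rewrite (negPf fK) (negPf xK).
  apply: (nb sides (missC w_f) fz (missC cx)); last exact: arc_adj.
  - exact/adjC/arc_adj.
  exact/arc_adj.
by move: (arcN xz); rewrite -ewz wx.
Qed.

(** Here [bx] is isolated, convenient both ways and oriented into [K], so [TtieK] supplies a rival
    [f'] of (x, b), which the conditions on neighborhoods exclude. *)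
Lemma feed_inside : f \in K -> False.
Proof.
move=> fK; have bK : b \notin K by rewrite (loses_cross fbcd) fK.
have [_ dK cK cb fd] := loses_out (loses_sym fbcd) bK.
have [[fb cd fc bd] [f_d b_c]] := losesE fbcd.
have [bx cx] := feed_missing.
have xK := miss_outK bx bK.
have SE (y z : V) : y \notin K -> z \notin K -> (y \in K) = (z \in K).
  by move=> /negPf-> /negPf->.
have KE (y z : V) : y \in K -> z \in K -> (y \in K) = (z \in K) by move=> -> ->.
have bb y : M b y -> D b y -> False by move=> by' /arc_adj; apply: miss_adj.
have nbeat p q : ~~ L p q b x.
  apply/negP => pqbx; have [[pq _ pb qx] _] := losesE pqbx.
  have [qbK pxK] := loses_side pqbx; rewrite xK in pxK; rewrite (negPf bK) in qbK.
  have qK := negbT qbK.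
  suff epd : p = d by move: (arcN bd); rewrite -epd pb.
  have [p_c|p_c] := missP (neq_inK pxK cK).
    by apply: (loses_nb2 fbcd); [apply: missC|apply/adjC/arc_adj].
  have q_f : M q f.
    have [/missC//|fq] := missP (neq_inK fK qK).
    case/eqP: xf; apply: esym; apply: (nb (SE b q bK qK) (missC fb) bx (missC pq)).
    - exact: adjC.
    - exact: arc_adj.
    exact/adjC/arc_adj.
  have epf : p = f.
    apply: (nb (SE q c qK cK) (missC pq) q_f cx (adjC p_c)); last exact: arc_adj.
    exact/adjC/arc_adj.
  by case: (miss_adj fb); rewrite -epf arc_adj.
have conv_bx := T_convenient bx Tbx nbeat.
have conv_xb : convenient x b.
  apply/negPn/negP => /convenientN[v vx vb].
  have vK : v \notin K by apply: adj_inK xK; apply/adjC/arc_adj.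
  have vf : v != f by rewrite eq_sym neq_inK.
  have [v_f|v_f] := missP vf; last first.
    have [q vqfb] := feed_unreach vx vb v_f.
    have [[vq _ _ qb] _] := losesE vqfb.
    case/eqP: xf; apply: esym; apply: (nb (SE b v bK vK) (missC fb) bx vq v_f).
      exact: arc_adj.
    exact/adjC/arc_adj.
  have v_c : ~~ R v c.
    apply/negP => /reachP[vc|[w vw wc]]; first exact: (reachN_path vb vc cb).
    have wb' : w != b by apply: contraTneq wc => ->; apply: arcN.
    have [wb|bw|w_b] := adjP wb'.
    - exact: (reachN_path vb vw wb).
    - exact: (reachN_path b_c bw wc).
    have ewf : w = f by apply: (loses_nb1 fbcd); [apply: missC|apply/adjC/arc_adj].
    by case: (miss_adj v_f); rewrite -ewf arc_adj.
  (* Again (v, f) is forced because [x] is not in Z; this unbeaten edge leaves the complement of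
     [K], so (f, v) is not convenient. *)
  have fvcx : L f v c x by rewrite /loses (missC v_f) cx fc vx fx v_c.
  have Tvf : T v f by rewrite Ttotal // (negPf (nZ fvcx)).
  have xd : x != d by apply/eqP => exd; apply: (bb x) => //; rewrite exd.
  have vd : M v d.
    have [/missC//|dv] := missP (neq_inK dK vK).
    case/eqP: xd; apply: esym; apply: (nb (SE c v cK vK) cd cx v_f (adjC dv)).
      exact: arc_adj.
    exact/adjC/arc_adj.
  have nvf p q : ~~ L p q v f.
    exact: (sun_unbeaten p q vK bK xK v_f vd vx (missC fb) bx (arc_adj bd)).
  have [u uf uv] := convenientN (Tpref vK (loses_sym fvcx) Tvf nvf).
  have uK : u \notin K by apply: adj_inK fK; apply/adjC/arc_adj.
  have ub : R u b.
    apply/negPn/negP => u_b; have [q uqfb _] := Tbad fb Tfb uf u_b.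
    apply: (negP (sun_unbeaten q u bK vK dK (missC fb) bx bd v_f vd (arc_adj vx))).
    exact: loses_sym.
  case/reachP: ub => [ub|[w uw wb]].
    have nuv : u != v.
      by apply/eqP => euv; case: (miss_adj v_f); rewrite -euv arc_adj.
    have /orP[u_v|vu] := adj_outK nuv uK vK; first by case/negP: (reachN_arc uv).
    exact: (reachN_path vb vu ub).
  have wv : w != v by apply: contraTneq wb => ->; apply: reachN_arc.
  have [w_v|vw|w_v] := adjP wv.
  - exact: (reachN_path uv uw w_v).
  - exact: (reachN_path vb vw wb).
  have ewd : w = d.
    apply: (nb (SE v b vK bK) (missC w_v) vd bx);
      [exact/adjC/arc_adj|exact: arc_adj|exact: arc_adj].
  by move: (arcN bd); rewrite -ewd wb.
have isol p q : ~~ L b x p q.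
  by apply/negP => bxpq; case/negP: (Tpref bK bxpq Tbx nbeat).
have [f' [c' [d' [f'K Tf'x f'xcd f'b]]]] := TtieK bK bx nbeat isol conv_bx conv_xb Tbx.
have [[f'x c'd' f'c' xd'] _] := losesE f'xcd.
have [_ c'K d'K d'f' xc'] := loses_out f'xcd f'K.
have bf' : b != f'.
  by apply/eqP => ebf; move: (isol c' d'); rewrite ebf f'xcd.
have {}bf' : D b f'.
  have /orP[//|f'_b] := adj_outK bf' bK f'K.
  by case/negP: (reachN_arc f'b).
have f'_neq := arc_neq bf'.
have bc' : M b c'.
  have [/missC//|c'b] := missP (neq_inK c'K bK).
  by case/eqP: f'_neq; apply: (loses_nb1 f'xcd); [apply: missC|].
(* As [b] dominates [f'], such a [v] reaches [b] through some [w], and an arc between [w] and [f']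
   in either direction is impossible. *)
have via v : R v b -> ~~ R v f' -> exists w, [/\ D v w, D w b & M f' w].
  move=> /reachP[vb|[w vw wb]] vf'; first by case: (reachN_path vf' vb bf').
  exists w; split => //; have wf' : w != f'.
    by apply: contraTneq vw => ->; apply: reachN_arc.
  have [w_f'|f'w|/missC//] := adjP wf'; first by case: (reachN_path vf' vw w_f').
  by case: (reachN_path f'b f'w wb).
have [/existsP[[p q] /= pqf'x]|] := boolP [exists e : V * V, L e.1 e.2 f' x].
  have [[pq _ pf' qx] [_ qf']] := losesE pqf'x.
  have [w [qw wb f'w]] := via q (convenientP _ _ conv_xb q qx) qf'.
  have pK : p \in K by have [_ ->] := loses_side pqf'x.
  have bp : M b p.
    have [/missC//|pb] := missP (neq_inK pK bK).
    case/eqP: f'_neq; apply: (nb (KE x p xK pK) (missC bx) (missC f'x) pq pb).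
      exact: arc_adj.
    exact/adjC/arc_adj.
  have epc : p = c'.
    apply: (nb (SE b f' bK f'K) bp bc' f'w); [exact/adjC/arc_adj|exact: arc_adj|].
    exact/adjC/arc_adj.
  by move: (arcN f'c'); rewrite -epc pf'.
rewrite negb_exists => /forallP npred.
have [v vx vf'] := convenientN (Tpref f'K f'xcd Tf'x (fun p q => npred (p, q))).
have [w [vw wb f'w]] := via v (convenientP _ _ conv_xb v vx) vf'.
have wK := miss_outK f'w f'K.
(* The condition [nb] settles the pairs among [w], [d], [c], [d'] and [f'] one by one, until [w] and
   [d] are two private neighbors of [c] against [b], which has [f] against [c]. *)
have wd : w != d by apply: contraTneq wb => ->; apply: arcN.
have wd' : M w d'.
  have [//|w_d'] := missP (neq_inK wK d'K).
  have ewx : w = x by apply: (loses_nb1 (loses_sym f'xcd)); [|apply: adjC].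
  by case: (miss_adj bx); rewrite -ewx; apply/adjC/arc_adj.
have df' : N d f'.
  have [d_f'|//] := missP (neq_inK dK f'K).
  case/eqP: wd; apply: (nb (SE f' b f'K bK) f'w (missC d_f') bc').
  - exact/adjC/arc_adj.
  - exact: arc_adj.
  exact: arc_adj.
have dd' : N d d'.
  have [d_d'|//] := missP (neq_inK dK d'K).
  case/eqP: f'_neq; apply: (nb (KE x d xK dK) (missC bx) (missC f'x) d_d' _ df').
    exact/adjC/arc_adj.
  exact: arc_adj.
have wc : M w c.
  have [//|w_c] := missP (neq_inK wK cK).
  by case/eqP: (arc_neq d'f'); apply: (nb (KE w d wK dK) wd' (missC f'w) (missC cd)).
case/eqP: wd; apply: (nb (SE c b cK bK) (missC wc) cd (missC fb)).
- exact/adjC/arc_adj.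
- exact: arc_adj.
exact/adjC/arc_adj.
Qed.

End Feed.

(** * Counting at the feed vertex *)

Lemma exists_second_neighborhood : 0 < #|V| -> exists v, #|outN D v| <= #|outN2 D v|.
Proof.
move=> V0; have [|f feed] := exists_feed (T := T) V0.
  by move=> x y /Ttotal->; case: (T y x).
exists f; pose lose b d := T f b && [exists c, L f b c d].
pose B := [set b | [exists d, lose b d]]; pose Z := [set d | [exists b, lose b d]].
have loseP b d : lose b d -> T f b /\ exists c, L f b c d.
  by case/andP => Tfb /existsP.
have BP b : b \in B -> T f b /\ exists c d, L f b c d.
  by rewrite inE => /existsP[d /loseP[Tfb [c fbcd]]]; split => //; exists c, d.
have ZP d : d \in Z -> exists b, T f b /\ exists c, L f b c d.
  by rewrite inE => /existsP[b /loseP[Tfb fbcd]]; exists b.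
have BI b c d : L f b c d -> T f b -> (b \in B) && (d \in Z).
  move=> fbcd Tfb; have bd : lose b d by rewrite /lose Tfb; apply/existsP; exists c.
  by rewrite !inE; apply/andP; split; apply/existsP; [exists d|exists b].
have outNB b : D f b -> b \notin B.
  move=> fb; apply/negP => /BP[_ [c [d fbcd]]].
  by have [[/miss_adj/(_ (arc_adj fb))]] := losesE fbcd.
have outNZ d : D f d -> d \notin Z.
  move=> fd; apply/negP => /ZP[b [_ [c fbcd]]].
  by have [_ [/reachN_arc/negP]] := losesE fbcd.
(* Each [b] determines its [d], so [g] maps B onto a set containing Z; the default [f] is never
   taken on B. *)
have ZB : #|Z| <= #|B|.
  pose g b := odflt f [pick d | lose b d].
  apply: leq_trans (leq_imset_card g B); apply/subset_leq_card/subsetP => d.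
  rewrite inE => /existsP[b bd]; apply/imsetP; exists b.
    by rewrite inE; apply/existsP; exists d.
  rewrite /g; case: pickP => [d' bd'|/(_ d)]; last by rewrite bd.
  have [_ [c fbcd]] := loseP _ _ bd; have [_ [c' fbcd']] := loseP _ _ bd'.
  exact: loses_target fbcd' fbcd.
have N2E x : (x \in outN2 D f) = R f x && ~~ D f x.
  rewrite /outN2 in_setD in_set; have [fx|fx] := boolP (D f x); first by rewrite andbF.
  rewrite /reach /= (negPf fx) andbT; apply/bigcupP/existsP => -[u].
    by rewrite !in_set => fu ux; exists u; rewrite fu.
  by case/andP => fu ux; exists u; rewrite in_set.
have: #|outN D f :|: B| <= #|(outN2 D f :|: Z) :\: B|.
  apply: feed.
  - rewrite in_setU in_set Dirr /=; apply/negP => /BP[_ [c [d fbcd]]].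
    by have [[/miss_neq]] := losesE fbcd; rewrite eqxx.
  - apply/pred0P => x /=; apply/negbTE/negP.
    rewrite in_setD !in_setU N2E [x \in outN D f]in_set.
    case/andP => /orP[fx|->//] /andP[_].
    by rewrite fx andbF /=; apply/negP; apply: outNZ.
  - move=> x; rewrite in_setU in_set => /orP[fx|/BP[Tfx [c [d fxcd]]]].
      by rewrite Ttotal ?negbK ?Tarc // eq_sym arc_neq.
    have [[/miss_neq fx _ _ _] _] := losesE fxcd.
    by rewrite Ttotal ?negbK // eq_sym.
  move=> p x pP xf xP xQ; apply/negP => Tpx.
  move: xP xQ; rewrite in_setD !in_setU N2E [x \in outN D f]in_set => /norP[fx xB].
  rewrite xB fx andbT /= => /norP[f_x xZ].
  have xp : x != p.
    apply/eqP => exp; move: pP; rewrite in_setU in_set -exp.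
    by rewrite (negPf fx) (negPf xB).
  move: pP; rewrite in_setU in_set => /orP[fp|/BP[Tfp [c [d fpcd]]]].
    (* If [p] is an out-neighbor of [f], then [px] is a missing edge and [Tbad] puts [x] in Z. *)
    have [xp'|px|/missC px] := adjP xp.
    - by move: Tpx; rewrite Ttotal ?Tarc // eq_sym.
    - exact: (reachN_path f_x fp px).
    have [b fbpx Tfb] := Tbad px Tpx fp f_x.
    by case/andP: (BI _ _ _ fbpx Tfb) => _; apply/negP.
  have nB c' d' : L f x c' d' -> ~~ T f x.
    by move=> fxcd; apply: contra xB => Tfx; case/andP: (BI _ _ _ fxcd Tfx).
  have nZ b' c' : L f b' c' x -> ~~ T f b'.
    by move=> fbcx; apply: contra xZ => Tfb; case/andP: (BI _ _ _ fbcx Tfb).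
  have [fK|fK] := boolP (f \in K).
    exact: (feed_inside fpcd Tfp Tpx xf xp f_x nZ fK).
  exact: (feed_outside fpcd Tfp Tpx xf xp f_x nB nZ fK).
have outNB0 : outN D f :&: B = set0.
  apply/setP => b; rewrite in_setI in_set in_set0; apply/negbTE/negP.
  by case/andP => /outNB/negP.
have := subset_leq_card (subsetDl (outN2 D f :|: Z) B).
have := cardsU (outN2 D f) Z; have := cardsU (outN D f) B.
by rewrite outNB0 cards0; lia.
Qed.
End Orientation.

(** * The completion to a tournament *)

Definition unbeaten (e : V * V) : bool := [forall e' : V * V, ~~ L e'.1 e'.2 e.1 e.2].

(** The default makes the first edge of a path a fixed point. *)
Definition loser_of (e : V * V) : V * V :=
  odflt e [pick e' : V * V | L e'.1 e'.2 e.1 e.2].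

(** Each step back along a path lowers [height], which is at most [#|V|], so this many steps reach
    the first edge. *)
Definition path_root (e : V * V) : V * V := iter #|V| loser_of e.

Lemma unbeatenP (a b : V) : reflect (forall p q, ~~ L p q a b) (unbeaten (a, b)).
Proof.
by apply: (iffP forallP) => [h p q|h [p q]]; [exact: (h (p, q))|exact: h].
Qed.

Lemma unbeatenN (e : V * V) : ~~ unbeaten e -> exists p q, L p q e.1 e.2.
Proof. by rewrite negb_forall => /existsP[[p q]]; rewrite negbK; exists p, q. Qed.

Lemma loser_ofE (p q a b : V) : L p q a b -> loser_of (a, b) = (p, q).
Proof.
rewrite /loser_of => pqab; case: pickP => [[p' q'] /= pqab'|/(_ (p, q))].
  by have [-> ->] := loses_inj pqab pqab'.
by rewrite pqab.
Qed.

Lemma loser_of_unbeaten (e : V * V) : unbeaten e -> loser_of e = e.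
Proof.
move=> /forallP ue; rewrite /loser_of; case: pickP => // e' le.
by move: (ue e'); rewrite le.
Qed.

Lemma unbeaten_swap (a b : V) : unbeaten (b, a) = unbeaten (a, b).
Proof.
by apply/unbeatenP/unbeatenP => h p q; apply/negP => /loses_sym; apply/negP.
Qed.

Lemma loser_of_swap (e : V * V) : loser_of (e.2, e.1) = ((loser_of e).2, (loser_of e).1).
Proof.
case: e => a b /=; have [u|/unbeatenN[p [q pqab]]] := boolP (unbeaten (a, b)).
  by rewrite !loser_of_unbeaten // unbeaten_swap.
by rewrite (loser_ofE pqab) (loser_ofE (loses_sym pqab)).
Qed.

(* The number of out-neighbors outside K of the end of e outside K; it makes sense
   only for a missing edge between K and its complement. *)
Definition height (e : V * V) : nat :=
  #|[set x | (x \notin K) && D (if e.1 \in K then e.2 else e.1) x]|.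

(** Let s and t be the ends outside [K]. As t is not reached from s, t dominates every out-neighbor
    of s outside [K], and also s itself. *)
Lemma loses_height (p q a b : V) : L p q a b -> height (p, q) < height (a, b).
Proof.
suff half s k l t : L s k l t -> s \notin K ->
    #|[set x | (x \notin K) && D s x]| < #|[set x | (x \notin K) && D t x]|.
  move=> pqab; have [qaK pbK] := loses_side pqab; have qpK := loses_cross pqab.
  rewrite /height /= -qaK qpK; have [pK|pK] := boolP (p \in K).
    by apply: half (loses_sym pqab) _; rewrite qpK pK.
  exact: half pqab pK.
move=> sklt sK; have [kK lK tK ts kl] := loses_out sklt sK.
have [_ [st _]] := losesE sklt.
apply: proper_card; apply/properP; split.
  apply/subsetP => x; rewrite !inE => /andP[xK sx]; rewrite xK /=.
  have tx : t != x by apply: contraTneq sx => <-; apply: reachN_arc.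
  have /orP[//|xt] := adj_outK tx tK xK.
  by case: (reachN_path st sx xt).
by exists s; rewrite !inE ?sK // Dirr.
Qed.

Lemma path_root_unbeaten (e : V * V) : unbeaten (path_root e).
Proof.
have: height e <= #|V| by apply: max_card.
rewrite /path_root; elim: #|V| e => [|n IH] [a b] le.
  apply/unbeatenP => p q; apply/negP => /loses_height.
  by move: le; rewrite leqn0 => /eqP->.
rewrite iterSr; have [u|/unbeatenN[p [q pqab]]] := boolP (unbeaten (a, b)).
  by rewrite loser_of_unbeaten //; elim: (n) => //= m um; rewrite loser_of_unbeaten.
by rewrite (loser_ofE pqab); apply: IH; rewrite -ltnS; apply: leq_trans le; apply: loses_height.
Qed.

Lemma path_root_id (e : V * V) : unbeaten e -> path_root e = e.
Proof.
by move=> u; rewrite /path_root; elim: #|V| => //= n ->; apply: loser_of_unbeaten.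
Qed.

Lemma path_root_loses (p q a b : V) : L p q a b -> path_root (a, b) = path_root (p, q).
Proof.
move=> pqab; rewrite -[LHS]loser_of_unbeaten ?path_root_unbeaten //.
by rewrite /path_root -iterS iterSr (loser_ofE pqab).
Qed.

Lemma path_root_swap (a b : V) :
  path_root (b, a) = ((path_root (a, b)).2, (path_root (a, b)).1).
Proof.
rewrite /path_root; elim: #|V| => //= n ->.
by rewrite loser_of_swap.
Qed.

Lemma path_root_miss (a b : V) : M a b -> M (path_root (a, b)).1 (path_root (a, b)).2.
Proof.
move=> ab; rewrite /path_root; elim: #|V| => //= n.
case: (iter n _ _) => p q /= pq.
have [u|/unbeatenN[p' [q' pq']]] := boolP (unbeaten (p, q)).
  by rewrite loser_of_unbeaten.
by rewrite (loser_ofE pq'); have [[]] := losesE pq'.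
Qed.

(** * Orientation of the missing edges *)

Definition tie_break (a b : V) : bool :=
  if (a \in K) == (b \in K) then enum_rank a < enum_rank b else a \in K.

Lemma tie_breakN (a b : V) : a != b -> tie_break a b = ~~ tie_break b a.
Proof.
move=> ab; rewrite /tie_break [(b \in K) == _]eq_sym; case: eqP => [_|].
  rewrite -leqNgt [RHS]leq_eqVlt; case: eqP => // /ord_inj /enum_rank_inj eab.
  by rewrite eab eqxx in ab.
by case: (a \in K) (b \in K) => [] [].
Qed.

Definition source_orient (a b : V) : bool :=
  if convenient a b && convenient b a then tie_break a b else convenient a b.

Definition path_orient (a b : V) : bool :=
  source_orient (path_root (a, b)).1 (path_root (a, b)).2.

Definition isolated (a b : V) : bool :=
  [forall e : V * V, ~~ L e.1 e.2 a b && ~~ L a b e.1 e.2].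

(** The use of [path_orient] avoids a circular definition: an edge that loses to another is not
    isolated, so the completion agrees with [path_orient] on it. *)
Definition rival (a b : V) : bool :=
  [exists f, exists c, exists d,
    [&& f \notin K, path_orient f a, L f a c d & ~~ R f b]].

(** Among two convenient orientations, one without a rival is preferred. *)
Definition isolated_orient (a b : V) : bool :=
  if convenient a b && convenient b a then
    if rival a b == rival b a then tie_break a b else rival b a
  else convenient a b.

Definition completion : rel V := fun a b =>
  D a b || M a b && if isolated a b then isolated_orient a b else path_orient a b.
Local Notation T := completion.

Lemma isolatedP (a b : V) :
  reflect ((forall p q, ~~ L p q a b) /\ (forall p q, ~~ L a b p q)) (isolated a b).
Proof.
apply: (iffP forallP) => [h|[h1 h2] [p q]]; last by rewrite h1 h2.
by split => p q; case/andP: (h (p, q)).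
Qed.

Lemma isolatedC (a b : V) : isolated a b = isolated b a.
Proof.
by apply/isolatedP/isolatedP => -[h1 h2]; split => p q; apply/negP => /loses_sym; apply/negP.
Qed.

Lemma isolatedN (a b c d : V) : L a b c d -> ~~ isolated a b /\ ~~ isolated c d.
Proof.
move=> abcd; split; apply/negP => /isolatedP[h1 h2].
  by move: (h2 c d); rewrite abcd.
by move: (h1 a b); rewrite abcd.
Qed.

Lemma completion_miss (a b : V) : M a b ->
  T a b = if isolated a b then isolated_orient a b else path_orient a b.
Proof.
by move=> ab; rewrite /T ab /=; case: (D a b) / boolP => // /arc_adj/(miss_adj ab).
Qed.

Lemma completion_loses (a b c d : V) : L a b c d -> T a b = T c d.
Proof.
move=> abcd; have [[ab cd _ _] _] := losesE abcd.
have [/negPf iab /negPf icd] := isolatedN abcd.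
by rewrite !completion_miss // iab icd /path_orient (path_root_loses abcd).
Qed.

Lemma source_orientN (a b : V) : M a b -> unbeaten (a, b) ->
  source_orient a b = ~~ source_orient b a.
Proof.
move=> ab /unbeatenP u; have := unbeaten_convenient ab u.
rewrite /source_orient (tie_breakN (miss_neq ab)).
by case: (convenient a b) (convenient b a) => [] [].
Qed.

Lemma completion_total (x y : V) : x != y -> T x y = ~~ T y x.
Proof.
move=> xy; have [xy'|yx|x_y] := adjP xy.
- rewrite /T xy' /= (negPf (arcN xy')) /=.
  by case: (M y x) / boolP => // /missC /miss_adj /(_ (arc_adj xy')).
- rewrite /T yx /= (negPf (arcN yx)) /=.
  by case: (M x y) / boolP => // /missC /miss_adj /(_ (arc_adj yx)).
rewrite !completion_miss ?(missC x_y) // [isolated y x]isolatedC.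
have [/isolatedP[/unbeatenP u _]|_] := ifP.
  have := source_orientN x_y u; rewrite /source_orient /isolated_orient.
  rewrite [rival y x == _]eq_sym [convenient y x && _]andbC.
  by case: (convenient x y && _) => //; case: (rival x y) (rival y x) => [] [].
rewrite /path_orient (path_root_swap x y) /=; apply: source_orientN.
  exact: path_root_miss.
by rewrite -surjective_pairing; apply: path_root_unbeaten.
Qed.

Lemma source_convenient (a b : V) : source_orient a b -> convenient a b.
Proof. by rewrite /source_orient; case: ifP => [/andP[]|]. Qed.

Lemma isolated_convenient (a b : V) : isolated_orient a b -> convenient a b.
Proof. by rewrite /isolated_orient; case: ifP => [/andP[]|]. Qed.

Lemma completion_bad (f c d : V) : M c d -> T c d -> D f c -> ~~ R f d ->
  exists2 b, L f b c d & T f b.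
Proof.
move=> cd; rewrite completion_miss // => Tcd fc fd.
have conv : ~~ convenient c d.
  by apply: contra fd => /convenientP /(_ f fc).
have [u|/unbeatenN[p [q /= pqcd]]] := boolP (unbeaten (c, d)); last first.
  (* The loser to [cd] starts at [f], and the orientation is constant along the path. *)
  have efp := loses_prev pqcd fc fd; rewrite -efp in pqcd.
  exists q => //; rewrite (completion_loses pqcd) completion_miss //.
case/negP: conv; move: Tcd; case: ifP => _; first exact: isolated_convenient.
by rewrite /path_orient path_root_id //; apply: source_convenient.
Qed.

Lemma completion_rivals (a b : V) : rivals a b T <-> rival a b.
Proof.
split=> [[f [c [d [fK Tfa facd fb]]]]|].
  apply/existsP; exists f; apply/existsP; exists c; apply/existsP; exists d.
  have [[fa _ _ _] _] := losesE facd; have [/negPf ifa _] := isolatedN facd.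
  by move: Tfa; rewrite completion_miss // ifa fK facd fb => ->.
case/existsP => f /existsP[c /existsP[d /and4P[fK Tfa facd fb]]]; exists f, c, d.
have [[fa _ _ _] _] := losesE facd; have [/negPf ifa _] := isolatedN facd.
by rewrite completion_miss // ifa.
Qed.

Lemma missing_split_second_neighborhood :
  0 < #|V| -> exists v, #|outN D v| <= #|outN2 D v|.
Proof.
apply: (@exists_second_neighborhood T).
- exact: completion_total.
- by move=> x y xy; rewrite /T xy.
- exact: completion_bad.
- move=> s k c d sK skcd Tsk /unbeatenP u; have [[sk _ _ _] _] := losesE skcd.
  have [/negPf isk _] := isolatedN skcd; move: Tsk.
  rewrite completion_miss // isk /path_orient path_root_id //= /source_orient.
  rewrite /tie_break (negPf sK) (miss_outK sk sK) /=.
  by case: (convenient k s); case: (convenient s k).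
- move=> a b ab h1 h2 cab cba; have iab : isolated a b by apply/isolatedP.
  rewrite !completion_rivals completion_miss // iab /isolated_orient cab cba /=.
  by move=> + rab; rewrite rab; case: (rival b a).
move=> s k sK sk h1 h2 csk cks; have isk : isolated s k by apply/isolatedP.
rewrite completion_rivals completion_miss // isk /isolated_orient csk cks /=.
rewrite /tie_break (negPf sK) (miss_outK sk sK) /=.
by case: (rival s k) (rival k s) => [] [].
Qed.

End MissingSplit.

Theorem theorem7 (V : finType) (D : rel V) (G : sgraph V)
    (hV : 0 < #|V|) (hD : oriented D) (hG : comb G) (hDG : missing D G) :
  exists v : V, #|outN D v| <= #|outN2 D v|.
Proof.
case: hD => Dirr Dasym; have [K [KK SS]] := comb_split hG.
apply: (@missing_split_second_neighborhood V D K) => //.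
- by move=> x y xK yK xy; rewrite -hDG KK.
- by move=> x y xK yK; rewrite -hDG SS.
move=> p q x y z pqK; rewrite -!hDG => px py qz /orP qx /orP qy /orP pz.
have adj u v : D u v \/ D v u -> ~~ edge G u v /\ v != u.
  move=> uv; rewrite hDG /missing_edge /=; split.
    by case: uv => ->; rewrite ?andbF.
  by apply/eqP => evu; move: uv; rewrite evu Dirr => -[].
have [qx' xq] := adj _ _ qx; have [qy' yq] := adj _ _ qy; have [pz' zp] := adj _ _ pz.
exact: (comb_neighborhoods hG KK SS pqK px py qz).
Qed.
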